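(* Let $n\ge 0$ be an integer, let $c_0\in\mathbb{R}$, and let $p,q$ be the strict Laurent polynomials with integer coefficients such that $i_n(x)=p(x)\sinh x+q(x)\cosh x$ for all real $x\neq 0$, where $i_n$ is the modified spherical Bessel function of the first kind. Let $x_{n,m}$ denote the $m$-th infsupum abscissa of $i_n$, and let $B$ be the set of all real branch numbers $b$ of $\mathrm{inverse}_b(i_n)$ for which the interval with endpoints $i_n(x_{n,b-1})$ and $i_n(x_{n,b})$ (the first endpoint included when finite, the second excluded) contains $c_0$. Then the set of all real solutions $x$ of the equation $$p(x)\sinh x+q(x)\cosh x=c_0,$$ where the left side is understood to have the value $1$ at $x=0$ if $n=0$ and the value $0$ at $x=0$ if $n>0$, is exactly $$\{\,\mathrm{inverse}_b(i_n)(c_0) : b\in B\,\}$$ (which is empty if $B$ is empty).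
   Context: A strict univariate Laurent polynomial is either $0$ or a finite sum of terms, each a numeric coefficient times a negative integer power of the variable. For integer $n\ge 0$, $i_n(x)=x^n\left(\frac1x\frac{d}{dx}\right)^n\frac{\sinh x}{x}$ for real $x\ne 0$, with $i_0(0)=1$ and $i_n(0)=0$ for $n>0$. Equivalently, for $x\ne0$, $i_0(x)=\frac{\sinh x}{x}$, $i_1(x)=-\frac{\sinh x}{x^2}+\frac{\cosh x}{x}$, and $i_{n+1}(x)=i_{n-1}(x)-\frac{2n+1}{x}i_n(x)$. For $x\ne 0$ each $i_n$ is thus of the form $p(x)\sinh x+q(x)\cosh x$ with $p,q$ strict Laurent polynomials with integer coefficients. Infsupum abscissas and branches of a function $f$: the real line is partitioned into maximal intervals on which $f$ is continuous and monotonic. The endpoints of these intervals (abscissas of local infima and suprema of $f$, including $\pm\infty$ for unbounded intervals) are called the infsupum abscissas. They are numbered consecutively in increasing order by integers $m$, so that number $1$ is the least positive one (possibly $+\infty$), and those to its left are $0,-1,\dots$. Branch number $b$ is the interval $[x_{n,b-1},x_{n,b})$ (infinite endpoints excluded). For even $n$ the branches are numbered $0$ (the interval $(-\infty,0)$) and $1$ (the interval $[0,\infty)$); for odd $n$ the only branch is number $1$ (the whole real line). For $c$ in the image of branch interval $b$ under $f$, $\mathrm{inverse}_b(f)(c)$ denotes the unique $x$ in branch interval $b$ with $f(x)=c$. Endpoint values $f(x_{n,b-1})$ and $f(x_{n,b})$ are interpreted as one-sided limits from inside the branch interval, possibly $\pm\infty$. *)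

(* Defs.v *)
From Stdlib Require Export Reals ZArith List ClassicalEpsilon.
From Coquelicot Require Export Coquelicot.
Open Scope R_scope.

(* Integer coefficients.  The list is a formal sum: the pair (a, k) is the term
   a x^(-k) with k >= 1, and the empty list is 0. *)
Definition strict_laurent : Type := list (Z * positive).

Definition laurent_eval (p : strict_laurent) (x : R) : R :=
  fold_right Rplus 0 (map (fun t => IZR (fst t) * powerRZ x (Z.neg (snd t))) p).

(* The expressions used for x <> 0 contain divisions by x; their value at 0 is
   prescribed separately. *)
Definition fill_at_0 (n : nat) (g : R -> R) (x : R) : R :=
  if Req_EM_T x 0 then (match n with O => 1 | S _ => 0 end) else g x.

(* Modified spherical Bessel function of the first kind. *)
Definition sph_bessel_i (n : nat) : R -> R :=
  fill_at_0 n (fun x =>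
    x ^ n * Nat.iter n (fun g y => / y * Derive g y) (fun y => sinh y / y) x).

Definition inside (a b : Rbar) (x : R) : Prop := Rbar_lt a x /\ Rbar_lt x b.

Definition continuous_on_interval (f : R -> R) (a b : Rbar) : Prop :=
  forall x, inside a b x -> continuous f x.

Definition monotonic_on_interval (f : R -> R) (a b : Rbar) : Prop :=
  (forall x y, inside a b x -> inside a b y -> x <= y -> f x <= f y) \/
  (forall x y, inside a b x -> inside a b y -> x <= y -> f y <= f x).

(* Only the endpoints of the maximal intervals are used below, so each interval
   is represented by its (nonempty) interior. *)
Definition maximal_interval (f : R -> R) (a b : Rbar) : Prop :=
  Rbar_lt a b /\
  continuous_on_interval f a b /\ monotonic_on_interval f a b /\
  forall a' b', Rbar_le a' a -> Rbar_le b b' ->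
    continuous_on_interval f a' b' -> monotonic_on_interval f a' b' ->
    a' = a /\ b' = b.

Definition infsupum_abscissa (f : R -> R) (a : Rbar) : Prop :=
  exists b, maximal_interval f a b \/ maximal_interval f b a.

Definition consecutive_infsupums (f : R -> R) (a a' : Rbar) : Prop :=
  infsupum_abscissa f a /\ infsupum_abscissa f a' /\ Rbar_lt a a' /\
  forall y, infsupum_abscissa f y -> ~ (Rbar_lt a y /\ Rbar_lt y a').

(* [infsupum_number f m a]: a is the infsupum abscissa of f with number m.  The
   numbering is partial: there may be no abscissa with a given number. *)
Inductive infsupum_number (f : R -> R) : Z -> Rbar -> Prop :=
| infsupum_one a :
    infsupum_abscissa f a -> Rbar_lt 0 a ->
    (forall y, infsupum_abscissa f y -> Rbar_lt 0 y -> Rbar_le a y) ->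
    infsupum_number f 1 a
| infsupum_next m a a' :
    infsupum_number f m a -> consecutive_infsupums f a a' ->
    infsupum_number f (m + 1) a'
| infsupum_prev m a a' :
    infsupum_number f m a' -> consecutive_infsupums f a a' ->
    infsupum_number f (m - 1) a.

(* Branch number b of f exists and has the endpoints a and a'. *)
Definition branch_endpoints (f : R -> R) (b : Z) (a a' : Rbar) : Prop :=
  infsupum_number f (b - 1) a /\ infsupum_number f b a'.

(* Since x is real, infinite endpoints are excluded. *)
Definition in_branch (f : R -> R) (b : Z) (x : R) : Prop :=
  exists a a', branch_endpoints f b a a' /\ Rbar_le a x /\ Rbar_lt x a'.

(* Arbitrary when there is no unique such x, that is, outside the domain of the
   inverse function. *)
Definition inverse_branch (f : R -> R) (b : Z) (c : R) : R :=
  epsilon (inhabits 0) (unique (fun x => in_branch f b x /\ f x = c)).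

(* u is the limit of f at the endpoint e of (a, a') from inside (a, a'). *)
Definition endpoint_value (f : R -> R) (a a' e u : Rbar) : Prop :=
  filterlim f (within (inside a a') (Rbar_locally e)) (Rbar_locally u).

(* The interval with endpoints u and v, in either order, with u included (when
   finite, c being real) and v excluded. *)
Definition between_endpoints (u v : Rbar) (c : R) : Prop :=
  (Rbar_le u c /\ Rbar_lt c v) \/ (Rbar_lt v c /\ Rbar_le c u).

(* The set of branch numbers denoted B for the right-hand side c. *)
Definition branch_set (f : R -> R) (c : R) (b : Z) : Prop :=
  exists a a' u v : Rbar,
    branch_endpoints f b a a' /\
    endpoint_value f a a' a u /\ endpoint_value f a a' a' v /\
    between_endpoints u v c.

(* Main.v *)
Require Import Defs.
From Stdlib Require Import Lra Lia.

(** Expanding [sinh x / x] in powers of [x ^ 2] gives an entire series in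
    [t = x ^ 2] all of whose coefficients are positive.  In the variable [t] the
    operator [(1/x) d/dx] is [2 d/dt], which preserves this positivity, so
    [i_n x = x ^ n * G (x ^ 2)] where [G] is entire with positive coefficients
    ([sph_bessel_i_series]).  Everything about the shape of [i_n] can be read off
    this formula: it is continuous on the whole line, strictly increasing and
    unbounded on [[0, +oo)] ([sph_bessel_i_increasing_unbounded]), and it has the
    parity of [n] ([sph_bessel_i_opp]).

    These facts determine the infsupum abscissas.  For even [n] there is a strict
    minimum at 0, so the maximal intervals are the two half-lines and the abscissas
    are [-oo], 0, [+oo] with numbers -1, 0, 1; for odd [n] the function increases
    from [-oo] to [+oo] and the abscissas are [-oo], [+oo] with numbers 0, 1.
    In both cases the branches partition the real line, and on each branch the
    function is a bijection onto the values lying between its endpoint values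
    (intermediate value theorem and strict monotonicity).  Hence a solution [x] of
    [i_n x = c] lies in one branch [b], this [b] belongs to the branch set of [c],
    and [x] is the value at [c] of the inverse of that branch; conversely each such
    inverse value is a solution ([solutions_by_branches]). *)

(** * Entire power series with positive coefficients *)

Definition entire_positive (a : nat -> R) : Prop :=
  CV_radius a = p_infty /\ forall k, 0 < a k.

Lemma entire_positive_ex a t : entire_positive a -> ex_pseries a t.
Proof. intros [Ha _]; apply CV_radius_inside; rewrite Ha; exact I. Qed.

Lemma entire_positive_decr a : entire_positive a -> entire_positive (PS_decr_1 a).
Proof.
intros [Ha Hpos]; split; [now rewrite CV_radius_decr_1 | intro k; apply Hpos].
Qed.

Lemma entire_positive_derive a :
  entire_positive a -> entire_positive (PS_scal 2 (PS_derive a)).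
Proof.
intros [Ha Hpos]; split.
- rewrite CV_radius_scal, CV_radius_derive; [exact Ha | lra].
- intro k; apply Rmult_lt_0_compat; [lra | apply Rmult_lt_0_compat].
  + apply lt_0_INR; lia.
  + apply Hpos.
Qed.

Lemma entire_positive_le a s t :
  entire_positive a -> 0 <= s <= t -> PSeries a s <= PSeries a t.
Proof.
intros Ha Hst; apply Series_le.
- intro k; split.
  + apply Rmult_le_pos; [left; apply Ha | apply pow_le; lra].
  + apply Rmult_le_compat_l; [left; apply Ha | now apply pow_incr].
- now apply ex_pseries_R, entire_positive_ex.
Qed.

(** Writing the series as [a 0 + t * b t] with [b t >= b 0 = a 1]; this linear
    bound is what makes the function unbounded at [+oo]. *)
Lemma entire_positive_ge a t :
  entire_positive a -> 0 <= t -> a 0%nat + t * a 1%nat <= PSeries a t.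
Proof.
intros Ha Ht; rewrite (PSeries_decr_1 a t) by now apply entire_positive_ex.
apply Rplus_le_compat_l, Rmult_le_compat_l; [exact Ht |].
change (a 1%nat) with (PS_decr_1 a 0%nat); rewrite <- PSeries_0.
now apply entire_positive_le; [apply entire_positive_decr | lra].
Qed.

Lemma entire_positive_pos a t : entire_positive a -> 0 <= t -> 0 < PSeries a t.
Proof.
intros Ha Ht; apply Rlt_le_trans with (PSeries a 0).
- rewrite PSeries_0; apply Ha.
- apply entire_positive_le; [exact Ha | lra].
Qed.

(** Comparing terms only gives a weak inequality between the sums.  Strictness
    comes from the factor [t] in [a 0 + t * b t], where [b] is nondecreasing and
    positive. *)
Lemma entire_positive_lt a s t :
  entire_positive a -> 0 <= s < t -> PSeries a s < PSeries a t.
Proof.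
intros Ha Hst.
assert (Hb := entire_positive_decr a Ha).
rewrite !(PSeries_decr_1 a) by now apply entire_positive_ex.
apply Rplus_lt_compat_l, Rle_lt_trans with (s * PSeries (PS_decr_1 a) t).
- apply Rmult_le_compat_l; [lra | apply entire_positive_le; [exact Hb | lra]].
- apply Rmult_lt_compat_r; [apply entire_positive_pos; [exact Hb | lra] | lra].
Qed.

Lemma entire_positive_derivable a t :
  entire_positive a -> is_derive (PSeries a) t (PSeries (PS_derive a) t).
Proof. intros [Ha _]; apply is_derive_PSeries; rewrite Ha; exact I. Qed.

(** Ratio test.  The two values of [r] that matter are 0 and 1, the even and the
    odd part of the exponential series. *)
Lemma entire_positive_inv_fact r :
  entire_positive (fun k => / INR (fact (2 * k + r))).
Proof.
split; [| intro k; apply Rinv_0_lt_compat, INR_fact_lt_0].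
apply CV_radius_infinite_DAlembert.
- intro k; apply Rinv_neq_0_compat, INR_fact_neq_0.
- apply is_lim_seq_le_le with (fun _ => 0) (fun k => / INR (S k)).
  + intro k.
    replace (2 * S k + r)%nat with (S (S (2 * k + r))) by lia.
    set (m := (2 * k + r)%nat).
    assert (Hm := INR_fact_lt_0 m).
    assert (H1 : 0 < INR (S m)) by (apply lt_0_INR; lia).
    assert (H2 : INR (S k) <= INR (S (S m))) by (apply le_INR; lia).
    assert (Hk : 0 < INR (S k)) by (apply lt_0_INR; lia).
    assert (H3 : 1 <= INR (S m)) by (change 1 with (INR 1); apply le_INR; lia).
    replace (/ INR (fact (S (S m))) / / INR (fact m))
      with (/ (INR (S (S m)) * INR (S m))).
    2: { change (fact (S (S m))) with (S (S m) * (S m * fact m))%nat.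
         rewrite !mult_INR; field; repeat split; lra. }
    rewrite Rabs_pos_eq.
    * split; [left; apply Rinv_0_lt_compat; nra | apply Rinv_le_contravar; nra].
    * left; apply Rinv_0_lt_compat; nra.
  + apply is_lim_seq_const.
  + apply (is_lim_seq_incr_1 (fun k => / INR k)).
    apply (is_lim_seq_inv INR p_infty); [apply is_lim_seq_INR | discriminate].
Qed.


(** * The modified spherical Bessel functions *)

(** Splitting the exponential series by parity gives
    [exp y = E (y ^ 2) + y * O (y ^ 2)]; in [exp x - exp (- x)] the even parts
    cancel. *)
Lemma sinh_over_series x :
  x <> 0 -> sinh x / x = PSeries (fun k => / INR (fact (2 * k + 1))) (x ^ 2).
Proof.
intro Hx; unfold sinh.
assert (Hexp : forall y, exp y =
  PSeries (fun k => / INR (fact (2 * k))) (y ^ 2)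
  + y * PSeries (fun k => / INR (fact (2 * k + 1))) (y ^ 2)).
{ intro y; rewrite <- (is_pseries_unique _ _ _ (is_exp_Reals y)).
  apply (PSeries_odd_even (fun k => / INR (fact k))).
  - apply (ex_pseries_ext (fun k => / INR (fact (2 * k + 0)))).
    + intro k; now rewrite Nat.add_0_r.
    + apply entire_positive_ex, entire_positive_inv_fact.
  - apply entire_positive_ex, entire_positive_inv_fact. }
rewrite (Hexp x), (Hexp (- x)).
replace ((- x) ^ 2) with (x ^ 2) by ring.
field; exact Hx.
Qed.

(** The iteration step is the action of [(1/x) d/dx] on functions of [x ^ 2],
    namely [2 d/dt] with [t = x ^ 2]. *)
Definition bessel_coeffs (n : nat) : nat -> R :=
  Nat.iter n (fun a => PS_scal 2 (PS_derive a)) (fun k => / INR (fact (2 * k + 1))).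

Lemma bessel_coeffs_entire_positive n : entire_positive (bessel_coeffs n).
Proof.
induction n as [| n IH].
- apply entire_positive_inv_fact.
- apply (entire_positive_derive _ IH).
Qed.

Lemma locally_nonzero (x : R) : x <> 0 -> locally x (fun y : R => y <> 0).
Proof. intro Hx; exact (open_neq 0 x Hx). Qed.

(** The right-hand side also takes the prescribed value at 0, so that the
    singular quotient of the definition need not be considered any more. *)
Lemma sph_bessel_i_series n x :
  sph_bessel_i n x = x ^ n * PSeries (bessel_coeffs n) (x ^ 2).
Proof.
unfold sph_bessel_i, fill_at_0; destruct (Req_EM_T x 0) as [-> | Hx].
- destruct n as [| n].
  + replace (0 ^ 2) with 0 by ring. rewrite PSeries_0; simpl; field.
  + simpl; ring.
- f_equal; revert x Hx.
  induction n as [| n IH]; intros x Hx; [now apply sinh_over_series |].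
  simpl Nat.iter.
  (* The induction hypothesis holds off 0 only, hence near [x] but not globally. *)
  rewrite (Derive_ext_loc _ (fun y => PSeries (bessel_coeffs n) (y ^ 2))).
  2: { generalize (locally_nonzero x Hx); apply filter_imp; exact IH. }
  change (bessel_coeffs (S n)) with (PS_scal 2 (PS_derive (bessel_coeffs n))).
  rewrite PSeries_scal.
  rewrite (is_derive_unique _ x (2 * x * PSeries (PS_derive (bessel_coeffs n)) (x ^ 2))).
  + field; exact Hx.
  + apply (is_derive_comp (PSeries (bessel_coeffs n)) (fun y => y ^ 2)).
    * apply entire_positive_derivable, bessel_coeffs_entire_positive.
    * auto_derive; [exact I | ring].
Qed.

(** Together with the parity of the function, these three properties determine its
    branches and its inverses. *)
Record increasing_unbounded (f : R -> R) : Prop := {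
  iu_continuous : forall x, continuous f x;
  iu_lt : forall x y, 0 <= x < y -> f x < f y;
  iu_lim : filterlim f (Rbar_locally p_infty) (Rbar_locally p_infty) }.

Lemma sph_bessel_i_increasing_unbounded n : increasing_unbounded (sph_bessel_i n).
Proof.
assert (Ha := bessel_coeffs_entire_positive n).
split.
- intro x.
  apply (continuous_ext (fun x => x ^ n * PSeries (bessel_coeffs n) (x ^ 2))).
  { intro y; symmetry; apply sph_bessel_i_series. }
  apply (ex_derive_continuous (V := R_NormedModule)).
  eexists; apply (is_derive_mult (fun x => x ^ n)
                   (fun x => PSeries (bessel_coeffs n) (x ^ 2))).
  + apply is_derive_pow, is_derive_id.
  + apply (is_derive_comp (PSeries (bessel_coeffs n)) (fun y => y ^ 2)).
    * now apply entire_positive_derivable.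
    * apply is_derive_pow, is_derive_id.
  + intros; apply Rmult_comm.
- intros x y Hxy; rewrite !sph_bessel_i_series.
  assert (Hsq : 0 <= x ^ 2 < y ^ 2) by nra.
  apply Rle_lt_trans with (y ^ n * PSeries (bessel_coeffs n) (x ^ 2)).
  + apply Rmult_le_compat_r.
    * left; apply entire_positive_pos; [exact Ha | lra].
    * apply pow_incr; lra.
  + apply Rmult_lt_compat_l.
    * apply pow_lt; lra.
    * now apply entire_positive_lt.
- intros P [M HM].
  assert (Ha0 := proj2 Ha 0%nat). assert (Ha1 := proj2 Ha 1%nat).
  exists (Rmax 1 (M / bessel_coeffs n 1)); intros x Hx; apply HM.
  (* For [x > 1] both [x ^ n >= 1] and [x ^ 2 >= x] hold, so the linear lower
     bound of the series at [x ^ 2] bounds the product as well. *)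
  assert (H1 : 1 < x) by (eapply Rle_lt_trans; [apply Rmax_l | exact Hx]).
  assert (H2 : M / bessel_coeffs n 1 < x)
    by (eapply Rle_lt_trans; [apply Rmax_r | exact Hx]).
  apply Rlt_div_l in H2; [| exact Ha1].
  assert (Hpow : 1 <= x ^ n) by (apply pow_R1_Rle; lra).
  assert (Hge := entire_positive_ge (bessel_coeffs n) (x ^ 2) Ha (pow2_ge_0 x)).
  rewrite sph_bessel_i_series.
  assert (x * bessel_coeffs n 1 <= x ^ 2 * bessel_coeffs n 1)
    by (apply Rmult_le_compat_r; nra).
  assert (M < PSeries (bessel_coeffs n) (x ^ 2)) by lra.
  assert (0 < PSeries (bessel_coeffs n) (x ^ 2)) 
    by (apply entire_positive_pos; [exact Ha | apply pow2_ge_0]).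
  nra.
Qed.

Lemma sph_bessel_i_opp n x : sph_bessel_i n (- x) = (-1) ^ n * sph_bessel_i n x.
Proof.
rewrite !sph_bessel_i_series.
replace (- x) with (-1 * x) by ring.
rewrite !Rpow_mult_distr; replace ((-1) ^ 2 * x ^ 2) with (x ^ 2) by ring; ring.
Qed.

(** * Functions of a given parity that increase on the half-line *)

Definition even_fun (f : R -> R) : Prop := forall x, f (- x) = f x.
Definition odd_fun (f : R -> R) : Prop := forall x, f (- x) = - f x.

Lemma even_decreasing f x y :
  increasing_unbounded f -> even_fun f -> x < y -> y <= 0 -> f y < f x.
Proof.
intros Hf He Hxy Hy; rewrite <- (He x), <- (He y); apply (iu_lt f Hf); lra.
Qed.

Lemma odd_increasing f x y :
  increasing_unbounded f -> odd_fun f -> x < y -> f x < f y.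
Proof.
intros Hf Ho Hxy.
assert (Hneg : forall s t, s < t <= 0 -> f s < f t).
{ intros s t Hst; apply Ropp_lt_cancel; rewrite <- !Ho; apply (iu_lt f Hf); lra. }
destruct (Rle_lt_dec 0 x) as [Hx | Hx]; [apply (iu_lt f Hf); lra |].
destruct (Rle_lt_dec y 0) as [Hy | Hy]; [apply Hneg; lra |].
apply Rlt_trans with (f 0); [apply Hneg; lra | apply (iu_lt f Hf); lra].
Qed.

Lemma half_line_onto f c :
  increasing_unbounded f -> f 0 <= c -> exists x, 0 <= x /\ f x = c.
Proof.
intros Hf Hc.
destruct (iu_lim f Hf (fun y => c < y)) as [M HM]; [now exists c |].
assert (HM0 := Rmax_l 0 M); assert (HM1 := Rmax_r 0 M).
assert (Hbig : c < f (Rmax 0 M + 1)) by (apply HM; lra).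
destruct (IVT_gen f 0 (Rmax 0 M + 1) c) as [x [Hx Hfx]].
- intro t; apply continuity_pt_filterlim, (iu_continuous f Hf).
- rewrite Rmin_left, Rmax_right; lra.
- exists x; split; [| exact Hfx].
  rewrite Rmin_left in Hx; lra.
Qed.

Lemma even_lim_m_infty f :
  increasing_unbounded f -> even_fun f ->
  filterlim f (Rbar_locally m_infty) (Rbar_locally p_infty).
Proof.
intros Hf He; apply (filterlim_ext (fun x => f (- x))); [exact He |].
apply (filterlim_comp _ _ _ Ropp f _ (Rbar_locally p_infty));
  [apply (filterlim_Rbar_opp m_infty) | apply (iu_lim f Hf)].
Qed.

Lemma odd_lim_m_infty f :
  increasing_unbounded f -> odd_fun f ->
  filterlim f (Rbar_locally m_infty) (Rbar_locally m_infty).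
Proof.
intros Hf Ho; apply (filterlim_ext (fun x => - f (- x))).
{ intro x; rewrite Ho; ring. }
apply (filterlim_comp _ _ _ (fun x => f (- x)) Ropp _ (Rbar_locally p_infty));
  [| apply (filterlim_Rbar_opp p_infty)].
apply (filterlim_comp _ _ _ Ropp f _ (Rbar_locally p_infty));
  [apply (filterlim_Rbar_opp m_infty) | apply (iu_lim f Hf)].
Qed.

(** * Endpoint values of a branch *)

(** This density makes the filter used for one-sided limits proper, hence those
    limits unique; it also supplies points of an interval near any endpoint. *)
Lemma inside_near_endpoint (a a' e : Rbar) (P : R -> Prop) :
  Rbar_lt a a' -> e = a \/ e = a' -> Rbar_locally e P ->
  exists x, inside a a' x /\ P x.
Proof.
intros Haa' He HP.
assert (Hm : exists m : R, inside a a' m).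
{ destruct a as [r | |], a' as [r' | |]; try easy; unfold inside; simpl in *.
  - exists ((r + r') / 2); lra.
  - exists (r + 1); lra.
  - exists (r' - 1); lra.
  - now exists 0. }
destruct Hm as [m [Ham Hma']].
destruct He as [-> | ->].
- destruct a as [r | |]; [| easy |]; simpl in HP, Ham.
  + destruct HP as [eps HP]; assert (Heps := cond_pos eps).
    exists (Rmin (r + eps / 2) m).
    assert (H1 := Rmin_l (r + eps / 2) m); assert (H2 := Rmin_r (r + eps / 2) m).
    assert (H3 : r < Rmin (r + eps / 2) m) by (apply Rmin_glb_lt; lra).
    split; [split; [exact H3 |] |].
    * now apply Rbar_le_lt_trans with m.
    * apply HP; change (Rabs (Rmin (r + eps / 2) m - r) < eps).
      rewrite Rabs_pos_eq; lra.
  + destruct HP as [M HP]; exists (Rmin (M - 1) m).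
    assert (H1 := Rmin_l (M - 1) m); assert (H2 := Rmin_r (M - 1) m).
    split; [split; [exact I |] |].
    * now apply Rbar_le_lt_trans with m.
    * apply HP; lra.
- destruct a' as [r | |]; [| | easy]; simpl in HP, Hma'.
  + destruct HP as [eps HP]; assert (Heps := cond_pos eps).
    exists (Rmax (r - eps / 2) m).
    assert (H1 := Rmax_l (r - eps / 2) m); assert (H2 := Rmax_r (r - eps / 2) m).
    assert (H3 : Rmax (r - eps / 2) m < r) by (apply Rmax_lub_lt; lra).
    split; [split; [| exact H3] |].
    * now apply Rbar_lt_le_trans with m.
    * apply HP; change (Rabs (Rmax (r - eps / 2) m - r) < eps).
      rewrite Rabs_left; lra.
  + destruct HP as [M HP]; exists (Rmax (M + 1) m).
    assert (H1 := Rmax_l (M + 1) m); assert (H2 := Rmax_r (M + 1) m).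
    split; [split; [| exact I] |].
    * now apply Rbar_lt_le_trans with m.
    * apply HP; lra.
Qed.

Lemma endpoint_value_unique f (a a' e u u' : Rbar) :
  Rbar_lt a a' -> e = a \/ e = a' ->
  endpoint_value f a a' e u -> endpoint_value f a a' e u' -> u = u'.
Proof.
intros Haa' He Hu Hu'.
assert (HF : ProperFilter' (within (inside a a') (Rbar_locally e))).
{ split; [| apply within_filter, Rbar_locally_filter].
  intro HP; destruct (inside_near_endpoint a a' e _ Haa' He HP) as [x [Hx Hn]].
  exact (Hn Hx). }
apply Rbar_le_antisym;
  [apply (filterlim_le f f u u' (FF := HF)) | apply (filterlim_le f f u' u (FF := HF))];
  try assumption; apply filter_forall; intro; apply Rle_refl.
Qed.

Lemma endpoint_value_of_lim f (a a' e u : Rbar) :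
  filterlim f (Rbar_locally e) (Rbar_locally u) -> endpoint_value f a a' e u.
Proof.
intro H; refine (filterlim_filter_le_1 f _ H).
apply filter_le_within.
Qed.

(** The endpoint values in the definition of the branch set are only asserted to
    exist; by uniqueness of one-sided limits they can be replaced by two-sided limits
    when these are known. *)
Lemma branch_set_of_lim f c b (a a' u v : Rbar) :
  Rbar_lt a a' ->
  (forall d d', branch_endpoints f b d d' <-> d = a /\ d' = a') ->
  filterlim f (Rbar_locally a) (Rbar_locally u) ->
  filterlim f (Rbar_locally a') (Rbar_locally v) ->
  branch_set f c b <-> between_endpoints u v c.
Proof.
intros Haa' Hb Hu Hv.
apply (endpoint_value_of_lim f a a') in Hu.
apply (endpoint_value_of_lim f a a') in Hv.
split.
- intros (d & d' & u' & v' & Hd & Hu' & Hv' & Hc).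
  apply Hb in Hd; destruct Hd as [-> ->].
  rewrite (endpoint_value_unique f a a' a u u') by auto.
  now rewrite (endpoint_value_unique f a a' a' v v') by auto.
- intro Hc; exists a, a', u, v; split; [now apply Hb | auto].
Qed.

(** * Branches of an even function *)

(** Such a function has a strict minimum at 0, so it takes larger values on both
    sides of 0. *)
Lemma even_not_monotonic f a b :
  increasing_unbounded f -> even_fun f -> Rbar_lt a 0 -> Rbar_lt 0 b ->
  ~ monotonic_on_interval f a b.
Proof.
intros Hf He Ha Hb Hmon.
assert (H0 : inside a b 0) by now split.
destruct (inside_near_endpoint a 0 0 (fun _ => True)) as (s & [Has Hs] & _);
  [exact Ha | now right | now apply filter_true |].
destruct (inside_near_endpoint 0 b 0 (fun _ => True)) as (t & [Ht Htb] & _);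
  [exact Hb | now left | now apply filter_true |].
simpl in Hs, Ht.
assert (Hfs := even_decreasing f s 0 Hf He Hs (Rle_refl 0)).
assert (Hft := iu_lt f Hf 0 t ltac:(lra)).
destruct Hmon as [Hmon | Hmon].
- assert (f s <= f 0); [| lra].
  apply Hmon; [split; [exact Has |] | exact H0 | lra].
  now apply Rbar_lt_trans with 0.
- assert (f t <= f 0); [| lra].
  apply Hmon; [exact H0 | split; [| exact Htb] | lra].
  now apply Rbar_lt_trans with 0.
Qed.

Lemma even_monotonic_neg f :
  increasing_unbounded f -> even_fun f -> monotonic_on_interval f m_infty 0.
Proof.
intros Hf He; right; intros x y [_ Hx] [_ Hy] [Hxy | ->]; [| apply Rle_refl].
simpl in Hx, Hy; left; apply even_decreasing; auto; lra.
Qed.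

Lemma monotonic_pos f :
  increasing_unbounded f -> monotonic_on_interval f 0 p_infty.
Proof.
intros Hf; left; intros x y [Hx _] [Hy _] [Hxy | ->]; [| apply Rle_refl].
simpl in Hx, Hy; left; apply (iu_lt f Hf); lra.
Qed.

Lemma continuous_on_any_interval f a b :
  increasing_unbounded f -> continuous_on_interval f a b.
Proof. intros Hf x _; apply (iu_continuous f Hf). Qed.

Lemma Rbar_le_p_infty (a : Rbar) : Rbar_le a p_infty.
Proof. now destruct a. Qed.

Lemma Rbar_m_infty_le (a : Rbar) : Rbar_le m_infty a.
Proof. now destruct a. Qed.

(** An interval of monotonicity cannot have 0 in its interior, so it is contained
    in one of the two half-lines; being maximal, it equals that half-line. *)
Lemma even_maximal_interval f (a b : Rbar) :
  increasing_unbounded f -> even_fun f ->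
  maximal_interval f a b <->
  (a = m_infty /\ b = Finite 0) \/ (a = Finite 0 /\ b = p_infty).
Proof.
intros Hf He; split.
- intros (Hab & _ & Hmon & Hmax).
  assert (Hcont := continuous_on_any_interval f).
  destruct (Rbar_lt_le_dec a 0) as [Ha | Ha].
  + destruct (Rbar_lt_le_dec 0 b) as [Hb | Hb].
    { now destruct (even_not_monotonic f a b Hf He Ha Hb). }
    left; destruct (Hmax m_infty 0); auto using even_monotonic_neg, Rbar_m_infty_le.
  + right; destruct (Hmax 0 p_infty); auto using monotonic_pos, Rbar_le_p_infty.
- intros [[-> ->] | [-> ->]].
  + split; [exact I |]; split; [now apply continuous_on_any_interval |].
    split; [now apply even_monotonic_neg |].
    intros a' b' Ha Hb _ Hmon.
    assert (a' = m_infty) as -> by now destruct a'.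
    split; [reflexivity |]; apply Rbar_le_antisym; [| exact Hb].
    apply Rbar_not_lt_le; intro Hlt.
    now apply (even_not_monotonic f m_infty b').
  + split; [exact I |]; split; [now apply continuous_on_any_interval |].
    split; [now apply monotonic_pos |].
    intros a' b' Ha Hb _ Hmon.
    assert (b' = p_infty) as -> by now destruct b'.
    split; [| reflexivity]; apply Rbar_le_antisym; [exact Ha |].
    apply Rbar_not_lt_le; intro Hlt.
    now apply (even_not_monotonic f a' p_infty).
Qed.

Lemma even_abscissa f (a : Rbar) :
  increasing_unbounded f -> even_fun f ->
  infsupum_abscissa f a <-> a = m_infty \/ a = Finite 0 \/ a = p_infty.
Proof.
intros Hf He; split.
- intros [b [H | H]]; apply even_maximal_interval in H; tauto.
- intros [-> | [-> | ->]].
  + exists 0; left; apply even_maximal_interval; auto.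
  + exists p_infty; left; apply even_maximal_interval; auto.
  + exists 0; right; apply even_maximal_interval; auto.
Qed.

Lemma even_consecutive f (a a' : Rbar) :
  increasing_unbounded f -> even_fun f ->
  consecutive_infsupums f a a' <->
  (a = m_infty /\ a' = Finite 0) \/ (a = Finite 0 /\ a' = p_infty).
Proof.
intros Hf He; split.
- intros (Ha & Ha' & Hlt & Hno).
  apply even_abscissa in Ha; auto; apply even_abscissa in Ha'; auto.
  destruct Ha as [-> | [-> | ->]], Ha' as [-> | [-> | ->]]; auto; simpl in Hlt;
    try easy; try lra.
  (* [-oo] and [+oo] are not consecutive: 0 lies between them. *)
  now destruct (Hno 0); [apply even_abscissa; auto |].
- intros [[-> ->] | [-> ->]];
  (split; [| split; [| split]]; [apply even_abscissa; auto .. | exact I |]);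
  intros y Hy; apply even_abscissa in Hy; auto;
  destruct Hy as [-> | [-> | ->]]; simpl; intros [H1 H2]; try easy; lra.
Qed.

(** The numbering starts from number 1, at [+oo], and moves down to 0 and then to
    [-oo]; there is no further abscissa on either side, so no other number
    occurs. *)
Lemma even_number f m (a : Rbar) :
  increasing_unbounded f -> even_fun f ->
  infsupum_number f m a <->
  (m = 1%Z /\ a = p_infty) \/ (m = 0%Z /\ a = Finite 0) \/
  (m = (-1)%Z /\ a = m_infty).
Proof.
intros Hf He; split.
- induction 1 as [a Ha Hpos _ | m a a' _ IH Hc | m a a' _ IH Hc].
  + apply even_abscissa in Ha; auto.
    destruct Ha as [-> | [-> | ->]]; simpl in Hpos; [easy | lra | auto].
  + apply even_consecutive in Hc; auto.
    destruct Hc as [[-> ->] | [-> ->]], IH as [[-> H] | [[-> H] | [-> H]]];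
      try discriminate H; auto.
  + apply even_consecutive in Hc; auto.
    destruct Hc as [[-> ->] | [-> ->]], IH as [[-> H] | [[-> H] | [-> H]]];
      try discriminate H; auto.
- assert (H1 : infsupum_number f 1 p_infty).
  { apply infsupum_one; [apply even_abscissa; auto | exact I |].
    intros y Hy Hpos; apply even_abscissa in Hy; auto.
    destruct Hy as [-> | [-> | ->]]; simpl in *; [easy | lra | easy]. }
  assert (H0 : infsupum_number f 0 0).
  { apply (infsupum_prev f 1 0 p_infty H1), even_consecutive; auto. }
  intros [[-> ->] | [[-> ->] | [-> ->]]]; [exact H1 | exact H0 |].
  apply (infsupum_prev f 0 m_infty 0 H0), even_consecutive; auto.
Qed.

Lemma even_branch f b (a a' : Rbar) :
  increasing_unbounded f -> even_fun f ->
  branch_endpoints f b a a' <->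
  (b = 0%Z /\ a = m_infty /\ a' = Finite 0) \/
  (b = 1%Z /\ a = Finite 0 /\ a' = p_infty).
Proof.
intros Hf He; unfold branch_endpoints; rewrite !even_number by assumption.
split.
- intros [[[H ->] | [[H ->] | [H ->]]] [[-> ->] | [[-> ->] | [-> ->]]]];
    try discriminate H; auto.
- intros [(-> & -> & ->) | (-> & -> & ->)]; auto 6.
Qed.

(** * Branches of an odd function *)

Lemma odd_monotonic f :
  increasing_unbounded f -> odd_fun f -> monotonic_on_interval f m_infty p_infty.
Proof.
intros Hf Ho; left; intros x y _ _ [Hxy | ->]; [| apply Rle_refl].
left; now apply odd_increasing.
Qed.

Lemma odd_maximal_interval f (a b : Rbar) :
  increasing_unbounded f -> odd_fun f ->
  maximal_interval f a b <-> a = m_infty /\ b = p_infty.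
Proof.
intros Hf Ho; split.
- intros (_ & _ & _ & Hmax).
  destruct (Hmax m_infty p_infty);
    auto using odd_monotonic, continuous_on_any_interval, Rbar_m_infty_le, Rbar_le_p_infty.
- intros [-> ->]; split; [exact I |]; split; [now apply continuous_on_any_interval |].
  split; [now apply odd_monotonic |].
  intros a' b' Ha Hb _ _; now destruct a', b'.
Qed.

Lemma odd_abscissa f (a : Rbar) :
  increasing_unbounded f -> odd_fun f ->
  infsupum_abscissa f a <-> a = m_infty \/ a = p_infty.
Proof.
intros Hf Ho; split.
- intros [b [H | H]]; apply odd_maximal_interval in H; tauto.
- intros [-> | ->].
  + exists p_infty; left; apply odd_maximal_interval; auto.
  + exists m_infty; right; apply odd_maximal_interval; auto.
Qed.

Lemma odd_consecutive f (a a' : Rbar) :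
  increasing_unbounded f -> odd_fun f ->
  consecutive_infsupums f a a' <-> a = m_infty /\ a' = p_infty.
Proof.
intros Hf Ho; split.
- intros (Ha & Ha' & Hlt & _).
  apply odd_abscissa in Ha; auto; apply odd_abscissa in Ha'; auto.
  now destruct Ha as [-> | ->], Ha' as [-> | ->].
- intros [-> ->]; split; [| split; [| split]]; [apply odd_abscissa; auto .. | exact I |].
  intros y Hy; apply odd_abscissa in Hy; auto.
  now destruct Hy as [-> | ->].
Qed.

Lemma odd_number f m (a : Rbar) :
  increasing_unbounded f -> odd_fun f ->
  infsupum_number f m a <->
  (m = 1%Z /\ a = p_infty) \/ (m = 0%Z /\ a = m_infty).
Proof.
intros Hf Ho; split.
- induction 1 as [a Ha Hpos _ | m a a' _ IH Hc | m a a' _ IH Hc].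
  + apply odd_abscissa in Ha; auto.
    now destruct Ha as [-> | ->]; [| left].
  + apply odd_consecutive in Hc; auto.
    destruct Hc as [-> ->], IH as [[-> H] | [-> H]]; [discriminate H | auto].
  + apply odd_consecutive in Hc; auto.
    destruct Hc as [-> ->], IH as [[-> H] | [-> H]]; [auto | discriminate H].
- assert (H1 : infsupum_number f 1 p_infty).
  { apply infsupum_one; [apply odd_abscissa; auto | exact I |].
    intros y Hy Hpos; apply odd_abscissa in Hy; auto.
    now destruct Hy as [-> | ->]. }
  intros [[-> ->] | [-> ->]]; [exact H1 |].
  apply (infsupum_prev f 1 m_infty p_infty H1), odd_consecutive; auto.
Qed.

Lemma odd_branch f b (a a' : Rbar) :
  increasing_unbounded f -> odd_fun f ->
  branch_endpoints f b a a' <-> b = 1%Z /\ a = m_infty /\ a' = p_infty.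
Proof.
intros Hf Ho; unfold branch_endpoints; rewrite !odd_number by assumption.
split.
- intros [[[H ->] | [H ->]] [[-> ->] | [-> ->]]]; try discriminate H; auto.
- intros (-> & -> & ->); auto.
Qed.

(** * Solving an equation branch by branch *)

(** Only two facts are needed: each point lies in a branch whose range of values
    contains its own, and each branch is injective and onto that range.  The latter
    makes the inverse, which is defined by a choice, the actual inverse. *)
Lemma solutions_by_branches f c :
  (forall x, exists b, in_branch f b x /\ branch_set f (f x) b) ->
  (forall b, branch_set f c b ->
     exists x, unique (fun x => in_branch f b x /\ f x = c) x) ->
  forall x, f x = c <-> exists b, branch_set f c b /\ x = inverse_branch f b c.
Proof.
intros Hcover Hinv x.
assert (Hspec : forall b, branch_set f c b ->
  unique (fun y => in_branch f b y /\ f y = c) (inverse_branch f b c)).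
{ intros b Hb; exact (epsilon_spec _ _ (Hinv b Hb)). }
split.
- intro Hx; destruct (Hcover x) as (b & Hin & Hb).
  rewrite Hx in Hb; exists b; split; [exact Hb |].
  symmetry; apply (Hspec b Hb); now split.
- intros (b & Hb & ->); apply (Hspec b Hb).
Qed.

Lemma even_in_branch f b x :
  increasing_unbounded f -> even_fun f ->
  in_branch f b x <-> (b = 0%Z /\ x < 0) \/ (b = 1%Z /\ 0 <= x).
Proof.
intros Hf He; unfold in_branch; split.
- intros (a & a' & Hb & Ha & Ha'); apply even_branch in Hb; auto.
  destruct Hb as [(-> & -> & ->) | (-> & -> & ->)]; simpl in *; auto.
- intros [[-> Hx] | [-> Hx]].
  + exists m_infty, 0; split; [apply even_branch; auto | now split].
  + exists 0, p_infty; split; [apply even_branch; auto | now split].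
Qed.

Lemma odd_in_branch f b x :
  increasing_unbounded f -> odd_fun f -> in_branch f b x <-> b = 1%Z.
Proof.
intros Hf Ho; unfold in_branch; split.
- intros (a & a' & Hb & _); apply odd_branch in Hb; tauto.
- intros ->; exists m_infty, p_infty; split; [apply odd_branch; auto | now split].
Qed.

(** The minimum [f 0] is attained at 0, which belongs to branch 1 only; hence the
    strict inequality for branch 0. *)
Lemma even_branch_set f c b :
  increasing_unbounded f -> even_fun f ->
  branch_set f c b <-> (b = 0%Z /\ f 0 < c) \/ (b = 1%Z /\ f 0 <= c).
Proof.
intros Hf He.
assert (H0 : branch_set f c 0 <-> between_endpoints p_infty (f 0) c).
{ apply (branch_set_of_lim f c 0 m_infty 0).
  - exact I.
  - intros d d'; rewrite even_branch by assumption; intuition discriminate.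
  - now apply even_lim_m_infty.
  - apply (iu_continuous f Hf). }
assert (H1 : branch_set f c 1 <-> between_endpoints (f 0) p_infty c).
{ apply (branch_set_of_lim f c 1 0 p_infty).
  - exact I.
  - intros d d'; rewrite even_branch by assumption; intuition discriminate.
  - apply (iu_continuous f Hf).
  - apply (iu_lim f Hf). }
split.
- intro Hb; assert (Hb' : b = 0%Z \/ b = 1%Z).
  { destruct Hb as (a & a' & _ & _ & Hb & _); apply even_branch in Hb; tauto. }
  unfold between_endpoints in *; simpl in *.
  destruct Hb' as [-> | ->]; tauto.
- unfold between_endpoints in *; simpl in *.
  intros [[-> Hc] | [-> Hc]]; tauto.
Qed.

Lemma odd_branch_set f c b :
  increasing_unbounded f -> odd_fun f -> branch_set f c b <-> b = 1%Z.
Proof.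
intros Hf Ho; split.
- intros (a & a' & _ & _ & Hb & _); apply odd_branch in Hb; tauto.
- intros ->; apply (branch_set_of_lim f c 1 m_infty p_infty m_infty p_infty).
  + exact I.
  + intros d d'; rewrite odd_branch by assumption; tauto.
  + now apply odd_lim_m_infty.
  + apply (iu_lim f Hf).
  + now left.
Qed.

Lemma even_solutions f c x :
  increasing_unbounded f -> even_fun f ->
  f x = c <-> exists b, branch_set f c b /\ x = inverse_branch f b c.
Proof.
intros Hf He; apply solutions_by_branches; clear x.
- intro x; destruct (Rlt_le_dec x 0) as [Hx | Hx]; [exists 0%Z | exists 1%Z];
  rewrite even_in_branch, even_branch_set by assumption.
  + split; [auto |]; left; split; [reflexivity |].
    apply even_decreasing; auto; lra.
  + split; [auto |]; right; split; [reflexivity |].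
    destruct Hx as [Hx | <-]; [left; apply (iu_lt f Hf); lra | apply Rle_refl].
- intros b Hb; apply even_branch_set in Hb; auto.
  (* Branch 0 is the mirror image of branch 1, so one preimage [x >= 0] serves for
     both. *)
  destruct (half_line_onto f c Hf) as (x & Hx & Hfx); [destruct Hb; lra |].
  destruct Hb as [[-> Hc] | [-> Hc]].
  + exists (- x); split.
    * rewrite even_in_branch, He by assumption; split; [left | exact Hfx].
      split; [reflexivity |].
      destruct Hx as [Hx | <-]; lra.
    * intros y [Hy Hfy]; apply even_in_branch in Hy; auto.
      destruct Hy as [[_ Hy] | [Hy _]]; [| discriminate Hy].
      rewrite <- (He x) in Hfx.
      destruct (Rtotal_order (- x) y) as [H | [H | H]]; [| exact H |];
        apply (even_decreasing f) in H; auto; lra.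
  + exists x; split.
    * rewrite even_in_branch by assumption; auto.
    * intros y [Hy Hfy]; apply even_in_branch in Hy; auto.
      destruct Hy as [[Hy _] | [_ Hy]]; [discriminate Hy |].
      destruct (Rtotal_order x y) as [H | [H | H]]; [| exact H |].
      -- assert (H' := iu_lt f Hf x y ltac:(lra)); lra.
      -- assert (H' := iu_lt f Hf y x ltac:(lra)); lra.
Qed.

Lemma odd_solutions f c x :
  increasing_unbounded f -> odd_fun f ->
  f x = c <-> exists b, branch_set f c b /\ x = inverse_branch f b c.
Proof.
intros Hf Ho; apply solutions_by_branches; clear x.
- intro x; exists 1%Z; now rewrite odd_in_branch, odd_branch_set.
- intros b Hb; apply odd_branch_set in Hb; auto; subst b.
  assert (Hex : exists x, f x = c).
  { assert (H0 := Ho 0); rewrite Ropp_0 in H0.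
    destruct (Rle_lt_dec 0 c) as [Hc | Hc].
    - destruct (half_line_onto f c Hf) as (x & _ & Hfx); [lra |]; now exists x.
    - destruct (half_line_onto f (- c) Hf) as (x & _ & Hfx); [lra |].
      exists (- x); rewrite Ho; lra. }
  destruct Hex as [x Hfx]; exists x; split.
  + now rewrite odd_in_branch.
  + intros y [_ Hfy].
    destruct (Rtotal_order x y) as [H | [H | H]]; [| exact H |];
      apply (odd_increasing f) in H; auto; lra.
Qed.

(** * The theorem *)

Theorem proposition3 (n : nat) (c0 : R) (p q : strict_laurent)
  (Hpq : forall x : R, x <> 0 ->
     sph_bessel_i n x = laurent_eval p x * sinh x + laurent_eval q x * cosh x) :
  forall x : R,
    fill_at_0 n (fun y => laurent_eval p y * sinh y + laurent_eval q y * cosh y) x = c0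
    <->
    exists b : Z, branch_set (sph_bessel_i n) c0 b /\
                  x = inverse_branch (sph_bessel_i n) b c0.
Proof.
intro x.
replace (fill_at_0 n _ x) with (sph_bessel_i n x).
2: { destruct (Req_EM_T x 0) as [-> | Hx].
     - unfold sph_bessel_i, fill_at_0; now destruct (Req_EM_T 0 0).
     - rewrite Hpq by exact Hx.
       unfold fill_at_0; now destruct (Req_EM_T x 0). }
assert (Hf := sph_bessel_i_increasing_unbounded n).
destruct (Nat.Even_or_Odd n) as [[k ->] | [k ->]].
- apply even_solutions; [exact Hf |].
  intro y; rewrite sph_bessel_i_opp, pow_1_even; ring.
- apply odd_solutions; [exact Hf |].
  intro y; rewrite sph_bessel_i_opp, Nat.add_1_r, pow_1_odd; ring.
Qed.
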